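(* Let $f:\{-1,1\}^n\to\{-1,1\}$ with $\mathrm{Deg}(f)\ge 1$. Then $f$ is $\rho$-SP for every $\rho\in[0,1]$ satisfying \[\rho\geq 1-\frac{1}{\mathrm{Deg}(f)\cdot\min\left\{\mathrm{Deg}(f),\ \sum_{S\subseteq[n]}|\hat f_S|\right\}}.\]
   Context: Fourier expansion: every $f:\{-1,1\}^n\to\{-1,1\}$ satisfies $f(x^n)=\sum_{S\subseteq[n]}\hat f_S x^S$ with $x^S=\prod_{i\in S}x_i$ and $\hat f_S=\mathbb{E}[f(X^n)X^S]$, $X^n$ uniform on $\{-1,1\}^n$. $\mathrm{Deg}(f)=\max\{|S|:\hat f_S\ne 0\}$. For $\rho\in[0,1]$, $T_\rho f(y^n)=\sum_{S}\rho^{|S|}\hat f_S y^S$ (this equals $\mathbb{E}[f(X^n)\mid Y^n=y^n]$ where $Y^n$ is $X^n$ with each coordinate independently flipped with probability $(1-\rho)/2$). $\operatorname{sgn}(0)=0$. $f$ is $\rho$-SP if for every $y^n$, $f(y^n)=\operatorname{sgn}T_\rho f(y^n)$ whenever $T_\rho f(y^n)\ne0$. *)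

(* Defs.v *)
From mathcomp Require Import all_boot all_order all_algebra.
From mathcomp Require Import reals.
Set Implicit Arguments.
Unset Strict Implicit.
Unset Printing Implicit Defensive.
Import Order.TTheory GRing.Theory Num.Theory.
Local Open Scope ring_scope.

(* {-1,1} is encoded by bool through b |-> (-1) ^+ b, i.e. false stands for 1
   and true for -1. *)
Definition pm {R : realType} (b : bool) : R := (-1) ^+ b.

Notation cube n := {ffun 'I_n -> bool}.

Definition boolfun (n : nat) : Type := cube n -> bool.

Section Fourier.
Variables (R : realType) (n : nat).
Implicit Types (f : boolfun n) (x y : cube n) (S : {set 'I_n}).

Definition chi S x : R := \prod_(i in S) pm (x i).

Definition expect (g : cube n -> R) : R := (\sum_x g x) / #|{: cube n}|%:R.

Definition fourier f S : R := expect (fun x => pm (f x) * chi S x).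

Definition Deg f : nat := (\max_(S : {set 'I_n} | (fourier f S != 0)%R) #|S|)%N.

Definition noise (rho : R) f y : R :=
  \sum_(S : {set 'I_n}) rho ^+ #|S| * fourier f S * chi S y.

Definition self_predicting (rho : R) f : Prop :=
  forall y, noise rho f y != 0 -> pm (f y) = Num.sg (noise rho f y).

End Fourier.

(* Main.v *)
Require Import Defs.
From mathcomp Require Import all_boot all_order all_algebra.
From mathcomp Require Import reals trigo.
From mathcomp Require Import ring lra.
Set Implicit Arguments.
Unset Strict Implicit.
Unset Printing Implicit Defensive.
Import Order.TTheory GRing.Theory Num.Theory.
Local Open Scope ring_scope.

(** Fix [y] and let [d := Deg f].  It suffices that [f(y) T_rho f(y) >= 0].  If
    the minimum is the spectral norm [L], this follows from
    [f(y) (f(y) - T_rho f(y)) <= \sum_S (1 - rho^|S|) |f_S| <= d (1 - rho) L].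
    If the minimum is [d], consider the polynomial [p(t) := f(y) T_t f(y)] of
    degree at most [d]: it satisfies [p(1) = 1] and, since [T_t] averages [f]
    against a probability kernel, [|p| <= 1] on [[-1, 1]].  Lagrange
    interpolation at the extremal points [cos (k pi / d)] of the Chebyshev
    polynomial [T_d] shows [p >= T_d] to the right of [cos (pi / d)], and [T_d]
    is nonnegative to the right of [cos (pi / (2 d)) <= 1 - 1 / d^2]. *)

(** * Lagrange interpolation and polynomials with alternating signs *)

Lemma lagrange_interpolation (F : fieldType) (m : nat) (x : 'I_m -> F)
    (h : {poly F}) (u : F) :
  injective x -> (size h <= m)%N ->
  h.[u] = \sum_k h.[x k] * \prod_(j | j != k) ((u - x j) / (x k - x j)).
Proof.
move=> xI sh.
pose l k := \prod_(j | j != k) ((x k - x j)^-1 *: ('X - (x j)%:P)).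
have lE k v : (l k).[v] = \prod_(j | j != k) ((v - x j) / (x k - x j)).
  by rewrite horner_prod; apply: eq_bigr => j _; rewrite !hornerE mulrC.
have sl k : (size (l k) <= m)%N.
  have : (size (l k) <= (\sum_(j | j != k) 1).+1)%N.
    rewrite /l; elim/big_rec2: _ => [|j a p _ IH]; first by rewrite size_poly1.
    apply: (leq_trans (size_polyMleq _ _)).
    have : (size ((x k - x j)^-1 *: ('X - (x j)%:P)) <= 2)%N.
      by rewrite (leq_trans (size_scale_leq _ _)) // size_XsubC.
    case: (size _) => [|s] s2; last first.
      by rewrite addSn /= -addnS; apply: leq_add s2 IH.
    by rewrite add0n (leq_trans (leq_pred _)) // (leq_trans IH) // ltnS leq_addl.
  by rewrite sum1_card cardC1 card_ord prednK //; apply: leq_ltn_trans (ltn_ord k).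
(* The difference of the two sides has size at most [m] and vanishes at the [m] distinct nodes, so
   it is the zero polynomial. *)
have /(congr1 (horner^~ u)) : h - \sum_k h.[x k] *: l k = 0.
  apply: (@roots_geq_poly_eq0 _ _ [seq x k | k <- enum 'I_m]).
  - apply/allP => _ /mapP[k _ ->]; rewrite rootE hornerD hornerN horner_sum.
    rewrite (bigD1 k) //= hornerZ lE big1 ?big1 ?mulr1 ?addr0 ?subrr //.
      move=> j jk; rewrite hornerZ lE (bigD1 k) 1?eq_sym //=.
      by rewrite subrr mul0r mul0r mulr0.
    move=> j jk; rewrite divff // subr_eq0; apply: contra jk => /eqP/xI ->.
    exact: eqxx.
  - by rewrite map_inj_uniq ?enum_uniq.
  - rewrite size_map size_enum_ord (leq_trans (size_polyD _ _)) // geq_max sh.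
    rewrite size_polyN (leq_trans (size_sum _ _ _)) //; apply/bigmax_leqP => k _.
    by rewrite (leq_trans (size_scale_leq _ _)).
rewrite !hornerE horner_sum => /eqP; rewrite subr_eq0 => /eqP ->.
by apply: eq_bigr => k _; rewrite hornerZ lE.
Qed.

(** Every term of the interpolation formula is nonnegative: [u] is to the right of all nodes and the
    nodes decrease, so the [k]-th basis polynomial at [u] has the sign [(-1)^k] or vanishes, and [h]
    at [x k] behaves likewise. *)
Lemma alternating_ge0 (R : realFieldType) (m : nat) (x : nat -> R)
    (h : {poly R}) (u : R) :
  (forall i j, (i < j < m)%N -> x j < x i) -> (size h <= m)%N ->
  (forall k, (k < m)%N -> 0 <= (-1) ^+ k * h.[x k]) ->
  (forall k, (k < m)%N -> x k <= u) -> 0 <= h.[u].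
Proof.
move=> xD sh alt xu.
have xI : injective (fun k : 'I_m => x k).
  move=> i j /= eqx; case: (ltngtP i j) => [ij|ji|/val_inj//].
    by have := xD i j; rewrite ij ltn_ord eqx ltxx => /(_ isT).
  by have := xD j i; rewrite ji ltn_ord eqx ltxx => /(_ isT).
rewrite (lagrange_interpolation u xI sh); apply: sumr_ge0 => k _.
(* One factor [-1] goes to each [j < k], where [x k - x j] is negative, so that the sign is absorbed
   factor by factor. *)
have sgn : (-1) ^+ k = \prod_(j : 'I_m | j != k) (-1) ^+ (j < k)%N :> R.
  transitivity (\prod_(j : 'I_m) (-1 : R) ^+ (j < k)%N); last first.
    by rewrite (bigD1 k) //= ltnn mul1r.
  rewrite -(big_mkord xpredT (fun j => (-1 : R) ^+ (j < k)%N)).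
  rewrite (@big_cat_nat _ _ _ k) ?(ltnW (ltn_ord k)) //=.
  rewrite [X in _ * X]big_nat_cond [X in _ * X]big1 ?mulr1.
    rewrite big_mkord (eq_bigr (fun=> -1)) ?prodr_const ?card_ord //.
    by move=> j _; rewrite ltn_ord.
  by move=> j /andP[/andP[kj _] _]; rewrite ltnNge kj.
have signM (a b : R) : a * b = ((-1) ^+ k * a) * ((-1) ^+ k * b).
  by rewrite mulrACA -expr2 sqrr_sign mul1r.
rewrite signM mulr_ge0 ?alt // sgn -big_split /= prodr_ge0 // => j jk.
rewrite mulrCA mulr_ge0 ?subr_ge0 ?xu //.
case: (ltngtP j k) jk => [jk _|kj _|/val_inj ->]; last by rewrite eqxx.
  by rewrite expr1 mulN1r oppr_ge0 invr_le0 subr_le0 ltW // xD // jk /=.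
by rewrite expr0 mul1r invr_ge0 subr_ge0 ltW // xD // kj /=.
Qed.

(** * Chebyshev polynomials of the first kind and their trigonometric form *)

Fixpoint chebyshev (R : nzRingType) (d : nat) : {poly R} :=
  match d with
  | 0 => 1
  | 1 => 'X
  | (d'.+1 as e).+1 => 'X * chebyshev R e *+ 2 - chebyshev R d'
  end.

Lemma size_chebyshev (R : nzRingType) (d : nat) :
  (size (chebyshev R d) <= d.+1)%N.
Proof.
suff: (size (chebyshev R d) <= d.+1 /\ size (chebyshev R d.+1) <= d.+2)%N by case.
elim: d => [|d [IH1 IH2]]; first by rewrite /= size_poly1 size_polyX.
split=> //; rewrite (leq_trans (size_polyD _ _)) // geq_max size_polyN.
apply/andP; split; last by rewrite (leq_trans IH1) // ltnW.
rewrite mulr2n (leq_trans (size_polyD _ _)) // maxnn.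
by rewrite (leq_trans (size_polyMleq _ _)) // size_polyX add2n.
Qed.

(** The recursion matches [cos (b + a) + cos (b - a) = 2 cos a cos b] at [b = (d + 1) a]. *)
Lemma chebyshev_cos (R : realType) (d : nat) (a : R) :
  (chebyshev R d).[cos a] = cos (d%:R * a).
Proof.
suff: (chebyshev R d).[cos a] = cos (d%:R * a) /\
      (chebyshev R d.+1).[cos a] = cos (d.+1%:R * a) by case.
elim: d => [|d [IH1 IH2]]; first by split; rewrite /= !hornerE ?mul0r ?mul1r ?cos0.
split=> //; rewrite -[chebyshev _ _]/('X * chebyshev R d.+1 *+ 2 - chebyshev R d).
rewrite !hornerE IH1 IH2.
have -> : d.+2%:R * a = d.+1%:R * a + a by rewrite -natr1 mulrDl mul1r.
have -> : d%:R * a = d.+1%:R * a - a by rewrite -natr1 mulrDl mul1r addrK.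
by rewrite cosB cosD; ring.
Qed.

Lemma cos_natmul_pi (R : realType) (k : nat) : cos (k%:R * pi) = (-1) ^+ k :> R.
Proof.
elim: k => [|k IH]; first by rewrite mul0r cos0.
by rewrite -natr1 mulrDl mul1r cosDpi IH exprS mulN1r.
Qed.

(** Taken at [k = d] and [a = pi / (4 d)], this bounds [sin (pi / (4 d))] below by
    [sin (pi / 4) / d], the source of the constant [1 / d^2]. *)
Lemma norm_sin_natmul (R : realType) (k : nat) (a : R) :
  `|sin (k%:R * a)| <= k%:R * `|sin a|.
Proof.
elim: k => [|k IH]; first by rewrite !mul0r sin0 normr0.
rewrite -natr1 !mulrDl !mul1r sinD (le_trans (ler_normD _ _)) // !normrM.
by rewrite lerD // ?(le_trans _ IH) // ?ler_piMr ?ler_piMl ?cos_max.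
Qed.

(* [1 - cos (pi / 2d) = 2 sin^2 (pi / 4d)] and [1/2 = sin^2 (pi / 4)]. *)
Lemma cos_pihalf_div_le (R : realType) (d : nat) :
  (0 < d)%N -> cos (pi / 2 / d%:R) <= 1 - (d%:R ^+ 2)^-1 :> R.
Proof.
move=> d0; have dR : 0 < d%:R :> R by rewrite ltr0n.
pose a : R := pi / 4 / d%:R.
have s4 : sin (d%:R * a) ^+ 2 = 1 / 2.
  have := cos_pihalf R; have -> : pi / 2 = (d%:R * a) *+ 2.
    by rewrite /a; field; rewrite gt_eqF.
  by rewrite cos_mulr2n sin2cos2 => c; lra.
have -> : pi / 2 / d%:R = a *+ 2 by rewrite /a; field; rewrite gt_eqF.
have le2 : 1 / 2 <= d%:R ^+ 2 * sin a ^+ 2.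
  rewrite -s4 -exprMn -[leLHS]real_normK ?num_real // -[leRHS]real_normK ?num_real //.
  by rewrite lerXn2r ?nnegrE // normrM normr_nat norm_sin_natmul.
have : (d%:R ^+ 2)^-1 <= 2 * sin a ^+ 2.
  by rewrite -[leLHS]mul1r ler_pdivrMr ?exprn_gt0 //; lra.
by rewrite cos_mulr2n cos2sin2; lra.
Qed.

(** * Comparison of bounded polynomials with Chebyshev polynomials *)

Lemma chebyshev_minorant (R : realType) (d : nat) (p : {poly R}) (u : R) :
  (0 < d)%N -> (size p <= d.+1)%N -> p.[1] = 1 ->
  (forall t, -1 <= t <= 1 -> `|p.[t]| <= 1) ->
  cos (pi / d%:R) <= u <= 1 -> (chebyshev R d).[u] <= p.[u].
Proof.
move=> d0 sp p1 pB /andP[xu u1]; have dR : 0 < d%:R :> R by rewrite ltr0n.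
pose x k : R := cos (k%:R * (pi / d%:R)).
have pid k : (k <= d)%N -> k%:R * (pi / d%:R) \in `[0 : R, pi].
  move=> kd; rewrite in_itv /= mulr_ge0 ?divr_ge0 ?pi_ge0 ?ler0n //=.
  by rewrite mulrCA ler_piMr ?pi_ge0 // ler_pdivrMr // mul1r ler_nat.
have xD i j : (i < j <= d)%N -> x j < x i.
  move=> /andP[ij jd]; rewrite ltr_cos ?pid ?(leq_trans (ltnW ij)) //.
  by rewrite ltr_pM2r ?divr_gt0 ?pi_gt0 // ltr_nat.
have x0 : x 0%N = 1 by rewrite /x mul0r cos0.
have Tx k : (chebyshev R d).[x k] = (-1) ^+ k.
  rewrite chebyshev_cos -cos_natmul_pi; congr cos; field.
  by rewrite gt_eqF.
pose q := p - chebyshev R d.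
have sq : (size q <= d.+1)%N.
  by rewrite (leq_trans (size_polyD _ _)) // geq_max size_polyN sp size_chebyshev.
(* Dividing by [X - 1] disposes of the node [x 0 = 1], which is not to the left of [u]; the quotient
   has size at most [d], so the [d] nodes [x 1, ..., x d], all at most [u], suffice. *)
have /factor_theorem[h qE] : root q 1.
  by have := Tx 0%N; rewrite x0 rootE !hornerE p1 => ->; rewrite subrr.
have sh : (size (- h) <= d)%N.
  rewrite size_polyN; have [->|h0] := eqVneq h 0; first by rewrite size_poly0.
  by move: sq; rewrite qE size_Mmonic ?monicXsubC // size_XsubC addn2.
have hu : 0 <= (- h).[u].
  (* At [x k.+1] the Chebyshev polynomial is [(-1)^(k+1)] and [|p| <= 1], so [q] has the opposite
     sign or vanishes. Division by the negative number [x k.+1 - 1] and the sign in [- h] leave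
     [(-1)^k]. *)
  apply: (@alternating_ge0 _ d (fun k => x k.+1)) => //.
  - by move=> i j /andP[ij jd]; apply: xD; rewrite !ltnS ij.
  - move=> k kd; have x1 : x k.+1 < 1 by rewrite -x0 xD.
    have : (-1) ^+ k.+1 * q.[x k.+1] <= 0.
      rewrite !hornerE Tx mulrBr -expr2 sqrr_sign subr_le0.
      rewrite (le_trans (ler_norm _)) // normrM normrX normrN1 expr1n mul1r.
      by rewrite pB // cos_geN1 cos_le1.
    rewrite qE hornerM hornerXsubC hornerN exprS mulrA mulN1r mulrN.
    by rewrite nmulr_lle0 ?subr_lt0 // mulNr.
  move=> k kd; rewrite (le_trans _ xu) //.
  have -> : cos (pi / d%:R) = x 1%N by rewrite /x mul1r.
  by case: k kd => // k kd; rewrite ltW // xD.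
rewrite -subr_ge0; have -> : p.[u] - (chebyshev R d).[u] = q.[u] by rewrite !hornerE.
by rewrite qE hornerM hornerXsubC -mulrNN -hornerN mulr_ge0 // opprB subr_ge0.
Qed.

Lemma bounded_poly_ge0 (R : realType) (d : nat) (p : {poly R}) (u : R) :
  (0 < d)%N -> (size p <= d.+1)%N -> p.[1] = 1 ->
  (forall t, -1 <= t <= 1 -> `|p.[t]| <= 1) ->
  1 - (d%:R ^+ 2)^-1 <= u <= 1 -> 0 <= p.[u].
Proof.
move=> d0 sp p1 pB /andP[du u1]; have dR : 0 < d%:R :> R by rewrite ltr0n.
have cu := le_trans (cos_pihalf_div_le R d0) du.
have pi2 : pi / 2 / d%:R \in `[0 : R, pi].
  rewrite in_itv /= !divr_ge0 ?pi_ge0 ?ler0n //= -mulrA ler_piMr ?pi_ge0 //.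
  by rewrite -invfM invf_le1 ?mulr_gt0 // -natrM ler1n muln_gt0.
have pi1 : pi / d%:R \in `[0 : R, pi].
  rewrite in_itv /= !divr_ge0 ?pi_ge0 ?ler0n //= ler_piMr ?pi_ge0 //.
  by rewrite invf_le1 // ler1n.
have uB : -1 <= u <= 1 by rewrite u1 (le_trans (cos_geN1 _) cu).
apply: le_trans (chebyshev_minorant d0 sp p1 pB _); last first.
  rewrite u1 andbT (le_trans _ cu) // ltW // ltr_cos // ltr_pM2r ?invr_gt0 //.
  by have := pi_gt0 R; lra.
(* With [u = cos a], the value to bound is [cos (d a)]; since the cosine decreases on [[0, pi]],
   [d a <= pi / 2] amounts to [cos (pi / (2 d)) <= u]. *)
have [/andP[a0 api] aE] := acos_def uB.
rewrite -aE chebyshev_cos cos_ge0_pihalf //.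
rewrite (le_trans _ (mulr_ge0 (ler0n _ _) a0)) ?oppr_le0 ?divr_ge0 ?pi_ge0 //=.
rewrite -ler_pdivlMl // mulrC leNgt -ltr_cos // ?in_itv /= ?a0 //.
by rewrite aE -leNgt.
Qed.

(** * The noise operator as an average and as a polynomial in its parameter *)

Section Noise.
Variables (R : realType) (n : nat) (f : boolfun n).
Implicit Types (x y : cube n) (t : R).

Let N : R := #|{: cube n}|%:R.

Let N_gt0 : 0 < N.
Proof. by rewrite ltr0n; apply/card_gt0P; exists [ffun=> false]. Qed.

Lemma sqr_pm (b : bool) : pm b * pm b = 1 :> R.
Proof. by rewrite -expr2 sqrr_sign. Qed.

Lemma norm_pm (b : bool) : `|pm b| = 1 :> R.
Proof. by rewrite normrX normrN1 expr1n. Qed.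

(** For [-1 <= t <= 1], this is [2^n] times the probability of reaching [x] from [y] when each
    coordinate flips independently with probability [(1 - t) / 2]. *)
Definition noise_kernel t x y : R := \prod_i (1 + t * (pm (x i) * pm (y i))).

(** Expanding the product over coordinates gives the sum over [S] of [t^|S| chi_S(x) chi_S(y)]. *)
Lemma noise_kernelE t y :
  noise t f y = (\sum_x pm (f x) * noise_kernel t x y) / N.
Proof.
rewrite /noise /fourier /expect mulr_suml.
under eq_bigr => S _ do rewrite mulrAC mulr_suml mulr_sumr.
rewrite exchange_big /=; apply: eq_bigr => x _.
under eq_bigr => S _ do rewrite mulrA.
rewrite -mulr_suml; congr (_ / _).
rewrite /noise_kernel; under [in RHS]eq_bigr => i _ do rewrite addrC.
rewrite (bigA_distr 1 +%R) /= mulr_sumr; apply: eq_bigr => S _.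
by rewrite -big_mkcond /= !big_split /= prodr_const /chi; ring.
Qed.

Lemma noise_kernel_ge0 t x y : -1 <= t <= 1 -> 0 <= noise_kernel t x y.
Proof.
move=> tB; apply: prodr_ge0 => i _.
by rewrite /pm; case: (x i); case: (y i); rewrite ?expr0 ?expr1; lra.
Qed.

Lemma sum_noise_kernel t y : \sum_x noise_kernel t x y = N.
Proof.
rewrite /noise_kernel -(bigA_distr_bigA (fun i b => 1 + t * (pm b * pm (y i)))).
rewrite (eq_bigr (fun=> 2)); last first.
  by move=> i _; rewrite big_bool /= /pm expr0 expr1; ring.
by rewrite prodr_const card_ord /N card_ffun card_bool card_ord natrX.
Qed.

Lemma norm_noise_le1 t y : -1 <= t <= 1 -> `|noise t f y| <= 1.
Proof.
move=> tB; rewrite noise_kernelE normrM normfV (gtr0_norm N_gt0).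
rewrite ler_pdivrMr // mul1r -(sum_noise_kernel t y).
rewrite (le_trans (ler_norm_sum _ _ _)) //; apply: ler_sum => x _.
by rewrite normrM norm_pm mul1r ger0_norm // noise_kernel_ge0.
Qed.

(** This is Fourier inversion: at [t = 1] a coordinate where [x] and [y] differ contributes the
    factor [0], so the whole mass of the kernel sits at [x = y]. *)
Lemma noise1 y : noise (1 : R) f y = pm (f y).
Proof.
have K0 x : x != y -> noise_kernel (1 : R) x y = 0.
  move=> xy; have /existsP[i xyi] : [exists i, x i != y i].
    apply: contraR xy => /existsPn xy; apply/eqP/ffunP => i.
    by apply/eqP; have := xy i; rewrite negbK.
  rewrite /noise_kernel (bigD1 i) //=; move: xyi.
  by rewrite /pm; case: (x i); case: (y i); rewrite //= mul1r ?mulr1 ?mul1r subrr mul0r.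
have := sum_noise_kernel 1 y; rewrite (bigD1 y) //= big1 => [|x /K0//].
rewrite addr0 noise_kernelE (bigD1 y) //= big1 => [->|x /K0 ->]; last by rewrite mulr0.
by rewrite addr0 mulfK // gt_eqF.
Qed.

Lemma leq_Deg (S : {set 'I_n}) : fourier R f S != 0 -> (#|S| <= Deg R f)%N.
Proof. by move=> fS; apply: (leq_bigmax_cond S). Qed.

Definition noise_poly y : {poly R} :=
  \sum_(S : {set 'I_n}) (fourier R f S * chi R S y) *: 'X^#|S|.

Lemma horner_noise_poly t y : (noise_poly y).[t] = noise t f y.
Proof.
rewrite /noise_poly horner_sum; apply: eq_bigr => S _.
by rewrite hornerZ hornerXn mulrC mulrA.
Qed.

Lemma size_noise_poly y : (size (noise_poly y) <= (Deg R f).+1)%N.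
Proof.
rewrite (leq_trans (size_sum _ _ _)) //; apply/bigmax_leqP => S _.
have [->|fS] := eqVneq (fourier R f S) 0; first by rewrite mul0r scale0r size_poly0.
by rewrite (leq_trans (size_scale_leq _ _)) // size_polyXn ltnS leq_Deg.
Qed.

Lemma norm_chi (S : {set 'I_n}) y : `|chi R S y| = 1.
Proof. by rewrite normr_prod big1 // => i _; rewrite norm_pm. Qed.

Lemma norm_noise_sub_le t y : 0 <= t <= 1 ->
  `|pm (f y) - noise t f y| <=
  (1 - t) * ((Deg R f)%:R * \sum_(S : {set 'I_n}) `|fourier R f S|).
Proof.
move=> /andP[t0 t1]; rewrite -noise1 /noise -sumrB mulrA mulr_sumr.
rewrite (le_trans (ler_norm_sum _ _ _)) //; apply: ler_sum => S _.
have [->|fS] := eqVneq (fourier R f S) 0.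
  by rewrite !mulr0 !mul0r subr0 normr0 mulr0.
rewrite expr1n -!mulrBl normrM norm_chi mulr1 normrM ler_wpM2r //.
rewrite ger0_norm ?subr_ge0 ?exprn_ile1 //.
(* [1 - t^|S|] is [1 - t] times a geometric sum of [|S|] terms, each at most [1]. *)
rewrite -opprB subrX1 -mulNr opprB ler_wpM2l ?subr_ge0 //.
rewrite (@le_trans _ _ (\sum_(i < #|S|) 1)) //.
  by apply: ler_sum => i _; rewrite exprn_ile1.
by rewrite sumr_const card_ord ler_nat leq_Deg.
Qed.

Lemma self_predicting_ge0 t :
  (forall y, 0 <= pm (f y) * noise t f y) -> self_predicting t f.
Proof.
move=> H y n0; have pos : 0 < pm (f y) * noise t f y.
  by rewrite lt0r H mulf_neq0 // -normr_eq0 norm_pm oner_eq0.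
have := gtr0_sg pos; rewrite sgrM => e.
rewrite -[LHS]mulr1 -e mulrA.
by rewrite /pm sgrX sgrN1 -expr2 sqrr_sign mul1r.
Qed.

End Noise.

Theorem theorem4p4 (R : realType) (n : nat) (f : boolfun n)
    (hdeg : (1 <= Deg R f)%N) (rho : R) (hrho0 : 0 <= rho) (hrho1 : rho <= 1)
    (hrho : 1 - ((Deg R f)%:R *
              Num.min (Deg R f)%:R (\sum_(S : {set 'I_n}) `|fourier R f S|))^-1
            <= rho) :
  self_predicting rho f.
Proof.
apply: self_predicting_ge0 => y; move: hrho; rewrite minEle; case: (leP _%:R) => [_ hrho|_].
  have pE t : (pm (f y) *: noise_poly R f y).[t] = pm (f y) * noise t f y.
    by rewrite hornerZ horner_noise_poly.
  rewrite -pE; apply: (@bounded_poly_ge0 _ (Deg R f)) => //.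
  - by rewrite (leq_trans (size_scale_leq _ _)) // size_noise_poly.
  - by rewrite pE noise1 sqr_pm.
  - by move=> t tB; rewrite pE normrM norm_pm mul1r norm_noise_le1.
  - by rewrite expr2 hrho hrho1.
set L := \sum_S _; set D := _%:R => hrho.
have L0 : 0 <= D * L by rewrite mulr_ge0 ?ler0n // sumr_ge0.
have le1 : (1 - rho) * (D * L) <= 1.
  (* The value [0], whose inverse is [0] by convention, is treated apart so that [D * L] can be
     cleared from the denominator in [hrho]. *)
  have [->|DL] := eqVneq (D * L) 0; first by rewrite mulr0.
  by rewrite -ler_pdivlMr ?lt0r ?DL // mul1r; lra.
have rho01 : 0 <= rho <= 1 by rewrite hrho0 hrho1.
have nle := le_trans (norm_noise_sub_le f y rho01) le1.
have -> : pm (f y) * noise rho f y = 1 - pm (f y) * (pm (f y) - noise rho f y).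
  by rewrite mulrBr sqr_pm; ring.
rewrite subr_ge0 (le_trans (ler_norm _)) //.
by rewrite normrM norm_pm mul1r.
Qed.
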